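(* Let $(d_i)_{i \ge 0}$ be a sequence of positive integers such that $d_0=1$ and $1 \le d_{i+1} \le d_i^{\langle i \rangle}$ for all $i \ge 1$. Then there exist an abelian semigroup $G$ and a subset $A \subseteq G$ such that $d_h = |hA|$ for all $h \ge 0$.
   Context: Binomial representation: let $h \ge 1$ be an integer. For every integer $a \ge 1$ there are unique integers $a_h > a_{h-1} > \cdots > a_1 \ge 0$ such that $a = \sum_{j=1}^h \binom{a_j}{j}$ (the $h$-binomial representation of $a$), where $\binom{m}{j}=0$ for integers $0 \le m < j$. With this representation one sets $a^{\langle h \rangle} = \sum_{j=1}^h \binom{a_j+1}{j+1}$. Iterated sumsets: for a subset $A$ of an abelian semigroup $(G,+)$ and an integer $h \ge 1$, $hA = A + \cdots + A$ ($h$ summands) is the set of all sums $a_1+\cdots+a_h$ with $a_1,\dots,a_h \in A$ (repetitions allowed). For $h=0$, $0A$ is by convention the one-element set $\{0\}$, so $|0A|=1$. *)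

(* Defs.v *)
From mathcomp Require Import all_boot.
From mathcomp Require Import zify.
From mathcomp Require Import boolp classical_sets functions cardinality.

Set Implicit Arguments.
Unset Strict Implicit.
Unset Printing Implicit Defensive.

Local Open Scope classical_set_scope.

(* Only the values c 1, ..., c h matter; c 1 >= 0 is automatic. *)
Definition binomial_rep (h a : nat) (c : nat -> nat) : Prop :=
  (forall i j, 1 <= i -> i < j -> j <= h -> c i < c j) /\
  a = \sum_(1 <= j < h.+1) 'C(c j, j).

Lemma binomial_rep_lt h a c m : 0 < h ->
  binomial_rep h a c -> c h < m -> a < 'C(m, h).
Proof.
elim: h a m => // h IHh a m _ [cinc ->] ltcm.
have lt_bin : 'C((c h.+1).+1, h.+1) <= 'C(m, h.+1) by rewrite leq_bin2l.
apply: leq_trans lt_bin; rewrite big_nat_recr //= binS addnC ltn_add2l.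
case: h IHh cinc ltcm => [|h] IHh cinc ltcm; first by rewrite big_nil bin0.
apply: IHh => //; last by apply: cinc.
by split=> // i j i1 ij jh; apply: cinc => //; apply: leqW.
Qed.

Lemma binomial_rep_exists h a : 0 < h -> exists c, binomial_rep h a c.
Proof.
move=> h0; have : h = 0 -> a = 0 by case: h h0.
move: h0 => _; elim: h a => [|h IHh] a ha.
  by exists id; rewrite /binomial_rep big_nil (ha erefl); split=> // i j; lia.
have exP : exists m, 'C(m, h.+1) <= a by exists 0; rewrite bin0n.
have ubP m : 'C(m, h.+1) <= a -> m <= a + h.+1.
  move=> mP; rewrite leqNgt; apply/negP => ltm.
  have : 'C((a + h.+1).+1, h.+1) <= a by apply: leq_trans mP; rewrite leq_bin2l.
  have binge k : k < 'C((k + h.+1).+1, h.+1).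
    elim: k => [|k IHk]; first by rewrite bin_gt0.
    rewrite addSn binS; have : 0 < 'C((k + h.+1).+1, h) by rewrite bin_gt0; lia.
    lia.
  by have := binge a; lia.
case: (ex_maxnP exP ubP) => m mP mmax.
have ltm : a - 'C(m, h.+1) < 'C(m, h).
  have : ~ 'C(m.+1, h.+1) <= a by move=> /mmax; lia.
  rewrite binS; lia.
have [|c [cinc ca]] := IHh (a - 'C(m, h.+1)).
  by move=> h0; move: ltm; rewrite h0 bin0; lia.
exists (fun j => if j == h.+1 then m else c j); split.
  move=> i j i1 ij jh; have /negPf -> : i != h.+1 by lia.
  case: (eqVneq j h.+1) => [jE|jN]; last by apply: cinc => //; lia.
  have ltch : c h < m.
    rewrite ltnNge; apply/negP => lemc; move: ltm; rewrite ca ltnNge => /negP; apply.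
    have h0 : 0 < h by lia.
    case: h h0 lemc {IHh exP ubP mP mmax ha ca cinc jE jh} => // h _ lemc.
    rewrite big_nat_recr //=; apply: leq_trans (leq_addl _ _).
    by rewrite leq_bin2l.
  case: (eqVneq i h) => [->//|iN]; apply: ltn_trans ltch.
  by apply: cinc => //; lia.
rewrite big_nat_recr //= eqxx -[LHS](subnK mP) ca; congr (_ + _).
by apply: eq_big_nat => j /andP[_ jh]; have /negPf -> : j != h.+1 by lia.
Qed.

Lemma binomial_rep_uniq h a c c' : binomial_rep h a c -> binomial_rep h a c' ->
  forall j, 1 <= j -> j <= h -> c j = c' j.
Proof.
elim: h a => [|h IHh] a; first by move=> _ _ j; lia.
move=> rc rc'.
have le c1 c2 : binomial_rep h.+1 a c1 -> binomial_rep h.+1 a c2 ->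
    c1 h.+1 <= c2 h.+1.
  move=> [_ a1] r2; rewrite leqNgt; apply/negP => /(binomial_rep_lt (ltn0Sn h) r2).
  by rewrite a1 big_nat_recr //=; lia.
have ceq : c h.+1 = c' h.+1 by apply/eqP; rewrite eqn_leq !le.
move=> j j1; rewrite leq_eqVlt => /orP[/eqP->//|jh].
have [[cinc ca] [cinc' ca']] := (rc, rc').
apply: (IHh (\sum_(1 <= j < h.+1) 'C(c j, j))) => //; split=> //.
- by move=> i k i1 ik kh; apply: cinc => //; lia.
- by move=> i k i1 ik kh; apply: cinc' => //; lia.
move: ca'; rewrite ca (@big_nat_recr _ _ _ h.+1) // (@big_nat_recr _ _ _ h.+1) //=.
by rewrite ceq => /addIn.
Qed.

(* The number a^<h>. For h > 0 the set below is a singleton, by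
   binomial_rep_exists and binomial_rep_uniq, so the default 0 is not used. *)
Definition macaulay (h a : nat) : nat :=
  xget 0 [set b | exists2 c, binomial_rep h a c &
                             b = \sum_(1 <= j < h.+1) 'C((c j).+1, j.+1)].

Lemma macaulayE h a c : binomial_rep h a c ->
  macaulay h a = \sum_(1 <= j < h.+1) 'C((c j).+1, j.+1).
Proof.
move=> rc; rewrite /macaulay; case: xgetP => [b _ [c' rc' ->]|/(_ _)].
  apply: eq_big_nat => j /andP[j1 jh].
  by rewrite (binomial_rep_uniq rc rc').
by move=> /(_ (\sum_(1 <= j < h.+1) 'C((c j).+1, j.+1))) []; exists c.
Qed.

(* The h-fold sumset hA. A semigroup need not have a zero, so sums are taken in
   option G, i.e. G with a formal zero None adjoined (oAC extends + to it).
   Thus 0A = {None}, and for h > 0 hA is the copy under Some of the sumset in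
   G, which leaves cardinalities unchanged. *)
Definition sumset (G : addSemigroupType) (A : set G) (h : nat) :
    set (option G) :=
  [set \big[oAC (@Algebra.addrA G) (@Algebra.addrC G) / None]_(i < h) Some (a i)
     | a in [set a : 'I_h -> G | forall i, A (a i)]].

Lemma sumset0 (G : addSemigroupType) (A : set G) : sumset A 0 = [set None].
Proof.
apply/seteqP; split=> x /=; first by case=> a _ <-; rewrite big_ord0.
by move=> ->; exists (fun i : 'I_0 => False_rect G (notF (ltn_ord i)));
  [case|rewrite big_ord0].
Qed.

Lemma sumset1 (G : addSemigroupType) (A : set G) : sumset A 1 = Some @` A.
Proof.
apply/seteqP; split=> x /=.
  by case=> a Aa <-; exists (a ord0); rewrite ?big_ord1.
by case=> g Ag <-; exists (fun=> g); rewrite ?big_ord1.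
Qed.

Lemma sumsetS (G : addSemigroupType) (A : set G) h :
  sumset A h.+2 =
  [set Some (Algebra.add x y) | x in A & y in [set y | sumset A h.+1 (Some y)]].
Proof.
apply/seteqP; split=> x /=.
  case=> a Aa <-; exists (a ord0) => //.
  have [y yE] : exists y, \big[oAC (@Algebra.addrA G) (@Algebra.addrC G) / None]_
      (i < h.+1) Some (a (lift ord0 i)) = Some y.
    by rewrite big_ord_recl; set s := \big[_/_]_(_ < h) _; case: s => [z|]; eexists.
  exists y; last by rewrite big_ord_recl yE.
  by exists (fun i => a (lift ord0 i)) => // i; apply: Aa.
case=> g Ag [y [a Aa aE] <-].
exists (fun i => if unlift ord0 i is Some j then a j else g).
  by move=> i; case: unliftP => [j|] _; [apply: Aa|].
rewrite big_ord_recl unlift_none.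
by under eq_bigr => i _ do rewrite liftK; rewrite aE.
Qed.

(* Main.v *)
(* The elements of the semigroup are lists of indices, read as monomials in
   variables [y_0 < y_1 < ...], and the sum of two of them is the normal form of
   their product. The [h]-binomial representation makes [rank] a bijection from
   monomials of degree [h] to [nat] that is increasing for the lexicographic
   order, and [a^<h>] is then the rank of [y_0 m], where [m] has rank [a]. Let
   the monomials of degree [h] and rank at least [d h] be bad; by the growth
   condition on [d] they form an ideal. Instead of being sent to zero, which
   would add an element to the sumsets, a bad monomial is rewritten by replacing
   one copy of its largest variable [y_b] by [y_(b-1)], until it is no longer
   bad. Normal forms are compatible with multiplication by [y_j]: let [m] be bad
   with largest variable [y_a] and one-step rewriting [m']. If [j > a], then
   [y_j w] is bad for all [w] of the degree of [m], so [y_j m] and [y_j m']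
   descend to [y_a m] and [y_a m']; if [j <= a], then [y_j m] rewrites to
   [y_j m'] at once. *)

Require Import Defs.
From mathcomp Require Import all_boot.
From mathcomp Require Import boolp classical_sets functions cardinality.
From HB Require Import structures.
From mathcomp Require Import zify.

(** On a nonincreasing list this counts the lexicographically smaller monomials of the same degree:
    the binomial counts those in [y_0, ..., y_(a-1)], the recursive call those with largest variable
    [y_a]. *)
Fixpoint rank (s : seq nat) : nat :=
  if s is a :: s' then 'C(a + size s', (size s').+1) + rank s' else 0.

Definition bad (d : nat -> nat) (s : seq nat) : bool := d (size s) <= rank s.

Definition step (d : nat -> nat) (s : seq nat) : seq nat :=
  if bad d s then sort geq ((head 0 s).-1 :: behead s) else s.

(** [sumn s] steps suffice, as each effective one lowers the sum of the indices by one. *)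
Definition normal_form (d : nat -> nat) (s : seq nat) : seq nat :=
  iter (sumn s) (step d) (sort geq s).

Definition macaulay_sequence (d : nat -> nat) : Prop :=
  [/\ d 0 = 1, forall i, 0 < d i
    & forall i, 0 < i -> d i.+1 <= macaulay i (d i)].

Lemma geq_total : total geq. Proof. by move=> x y /=; lia. Qed.
Lemma geq_trans : transitive geq. Proof. by move=> x y z /=; lia. Qed.
Lemma geq_anti : antisymmetric geq. Proof. by move=> x y /=; lia. Qed.

Lemma path_geqE a s : path geq a s = all (geq a) s && sorted geq s.
Proof. exact: path_sortedE geq_trans a s. Qed.

Lemma sort_geq_id s : sorted geq s -> sort geq s = s.
Proof. exact: sorted_sort geq_trans s. Qed.

Lemma perm_sort_geq s t : perm_eq s t -> sort geq s = sort geq t.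
Proof. by move=> /(perm_sortP geq_total geq_trans geq_anti). Qed.

Lemma sort_geq_cons a s : all (geq a) s -> sort geq (a :: s) = a :: sort geq s.
Proof.
move=> as_; rewrite -[RHS]sort_geq_id.
  by apply: perm_sort_geq; rewrite perm_cons perm_sym perm_sort.
by rewrite /= path_geqE all_sort as_ sort_sorted //; apply: geq_total.
Qed.

Lemma sumn_sort s : sumn (sort geq s) = sumn s.
Proof. by apply: perm_sumn; rewrite perm_sort. Qed.

(** * Rank and the lexicographic order *)

Lemma rank_lt a s : path geq a s -> rank s < 'C(a + size s, size s).
Proof.
elim: s a => [|b s IHs] a /=; first by rewrite bin0.
move=> /andP[ba /IHs lt_s].
apply: (@leq_trans 'C((b + size s).+1, (size s).+1)).
  by rewrite binS ltn_add2l.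
by rewrite leq_bin2l // addnS ltnS leq_add2r.
Qed.

Lemma rank_cons_lt a b s t : size s = size t -> path geq b t -> b < a ->
  rank (b :: t) < rank (a :: s).
Proof.
move=> st bt ba.
have /rank_lt : path geq b (b :: t) by rewrite /= leqnn.
move=> /leq_trans; apply; apply: leq_trans (leq_addr _ _).
by rewrite /= -st leq_bin2l //; lia.
Qed.

Lemma rank_inj s t : sorted geq s -> sorted geq t -> size s = size t ->
  rank s = rank t -> s = t.
Proof.
elim: s t => [|a s IHs] [|b t] //= ss tt [st].
case: (ltngtP a b) => [ab|ba|->].
- move=> rst; have := rank_cons_lt _ _ _ _ (esym st) ss ab.
  by rewrite /= rst ltnn.
- move=> rst; have := rank_cons_lt _ _ _ _ st tt ba.
  by rewrite /= rst ltnn.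
rewrite st => /addnI rst; congr (_ :: _).
by apply: IHs => //; [apply: path_sorted ss|apply: path_sorted tt].
Qed.

Lemma path_rcons0 a s : path geq a s -> path geq a (rcons s 0).
Proof. by rewrite rcons_path => -> /=. Qed.

(** The first differing variable decides the comparison, and appending [y_0] to both lists leaves it
    in place. *)
Lemma leq_rank_rcons0 s t : sorted geq s -> sorted geq t -> size s = size t ->
  rank s <= rank t -> rank (rcons s 0) <= rank (rcons t 0).
Proof.
elim: s t => [|a s IHs] [|b t] // ss tt [st].
case: (ltngtP a b) => [ab|ba|<-] rst.
- apply/ltnW/rank_cons_lt => //; first by rewrite !size_rcons st.
  exact: path_rcons0.
- by have := rank_cons_lt _ _ _ _ st tt ba; rewrite ltnNge rst.
move: rst; rewrite /= !size_rcons st !leq_add2l.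
by apply: IHs => //; [apply: path_sorted ss|apply: path_sorted tt].
Qed.

Lemma leq_rank_rcons0_rem j s : sorted geq s -> j \in s ->
  rank (rcons (rem j s) 0) <= rank s.
Proof.
(* As [a :: t] is nonincreasing, it dominates [rcons t 0] position by position. *)
have rank_tail a t : path geq a t -> rank (rcons t 0) <= rank (a :: t).
  elim: t a => [|b t IHt] a //= /andP[ba bt].
  rewrite size_rcons; apply: leq_add; last exact: IHt.
  by apply: leq_bin2l; lia.
elim: s => //= a s IHs as_; rewrite in_cons eq_sym.
case: eqVneq => [_ _|_ /= js]; first exact: rank_tail.
rewrite size_rcons size_rem // prednK; last by case: (s) js.
by rewrite leq_add2l; apply: IHs => //; apply: path_sorted as_.
Qed.

(* The h-binomial representation [a_h, ..., a_1] of the rank of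
   [b_h :: ... :: b_1] is [a_j = b_j + (j - 1)]. *)
Lemma macaulay_rank h a : 0 < h -> exists s, [/\ sorted geq s, size s = h,
  rank s = a & macaulay h a = rank (rcons s 0)].
Proof.
move=> h0; have [c rc] := binomial_rep_exists a h0.
rewrite (macaulayE rc); case: rc => cinc -> {a}.
suff [s [ss sh r1 r2 _]] : exists s, [/\ sorted geq s, size s = h,
    rank s = \sum_(1 <= j < h.+1) 'C(c j, j),
    rank (rcons s 0) = \sum_(1 <= j < h.+1) 'C((c j).+1, j.+1) &
    head 0 s + h.-1 = c h] by exists s.
case: h h0 cinc => // h _; elim: h => [|h IHh] cinc.
  by exists [:: c 1]; rewrite !big_nat1 /= !addn0 addn1 bin1.
have [|s [ss sh r1 r2 hs]] := IHh.
  by move=> i j i1 ij jh; apply: cinc => //; apply: leqW.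
have c_lt : c h.+1 < c h.+2 by apply: cinc.
have lt_c : h.+1 <= c h.+2 by lia.
exists (c h.+2 - h.+1 :: s); split=> //=.
- rewrite path_geqE ss andbT; case: (s) ss sh hs => //= b t.
  rewrite path_geqE => /andP[/allP bt _] _ hs.
  by apply/andP; split; [lia|apply/allP => x /bt /=; lia].
- by rewrite sh.
- by rewrite big_nat_recr //= -r1 sh addnC subnK.
- by rewrite big_nat_recr //= -r2 size_rcons sh addnC addnS subnK.
by rewrite subnK.
Qed.

(** * Bad monomials form an ideal *)

Lemma bad_growth d m : macaulay_sequence d -> sorted geq m -> 0 < size m ->
  bad d m -> d (size m).+1 <= rank (rcons m 0).
Proof.
move=> [_ _ dM] ms m0 bm; apply: leq_trans (dM _ m0) _.
(* [u] is the least bad monomial of the degree of [m], and the growth bound is the rank of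
   [y_0 u]. *)
have [u [us um ru ->]] := macaulay_rank _ (d (size m)) m0.
by apply: leq_rank_rcons0 => //; rewrite ru.
Qed.

Lemma bad_nil d : macaulay_sequence d -> bad d [::] = false.
Proof. by case=> d0 _ _; rewrite /bad /= d0. Qed.

(** If [m = rem j s] is bad, so is [y_0 m], and trading [y_0] for [y_j] does not lower the rank. *)
Lemma bad_rem d j s : macaulay_sequence d -> sorted geq s -> j \in s ->
  bad d (rem j s) -> bad d s.
Proof.
move=> dM ss js; case: (posnP (size (rem j s))) => [/size0nil->|s0 brs].
  by rewrite bad_nil.
have srs : sorted geq (rem j s).
  by apply: subseq_sorted ss; [apply: geq_trans|apply: rem_subseq].
rewrite /bad; apply: leq_trans (leq_rank_rcons0_rem j _ ss js).
have := bad_growth _ _ dM srs s0 brs; rewrite size_rem // prednK //.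
by case: (s) js.
Qed.

Lemma bad_sort_cons d j s : macaulay_sequence d -> sorted geq s -> bad d s ->
  bad d (sort geq (j :: s)).
Proof.
move=> dM ss bs; apply: (bad_rem _ j) => //.
- exact/sort_sorted/geq_total.
- by rewrite mem_sort mem_head.
suff -> : rem j (sort geq (j :: s)) = s by [].
apply: (sorted_eq geq_trans geq_anti) => //.
  apply: (subseq_sorted geq_trans (rem_subseq _ _)).
  exact/sort_sorted/geq_total.
rewrite -(perm_cons j) -(permPl (perm_to_rem _)).
  by rewrite perm_sort.
by rewrite mem_sort mem_head.
Qed.

(* Above the largest variable of some bad monomial, everything of the next
   degree is bad. *)
Lemma bad_cons_gt d a j m w : macaulay_sequence d ->
  path geq a m -> bad d (a :: m) -> a < j -> size w = (size m).+1 ->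
  bad d (j :: w).
Proof.
move=> dM am bam aj wm; rewrite /bad /= wm.
apply: leq_trans (bad_growth _ (a :: m) dM am _ bam) _ => //.
apply: ltnW; apply: leq_trans (leq_addr _ _).
apply: leq_trans (@rank_lt a (rcons (a :: m) 0) _) _.
  by rewrite /= leqnn; apply: path_rcons0.
by rewrite size_rcons /= leq_bin2l //; lia.
Qed.

Lemma bad_nseq0 d n : macaulay_sequence d -> bad d (nseq n 0) = false.
Proof.
move=> [_ d0 _]; rewrite /bad leqNgt size_nseq; apply/negbF.
suff -> : rank (nseq n 0) = 0 by [].
by elim: n => //= n ->; rewrite size_nseq bin_small.
Qed.

(** A power of [y_0] has rank 0 and is never bad, since [d] is positive; hence [step] never
    truncates a predecessor. *)
Lemma bad_head_gt0 d a s : macaulay_sequence d -> path geq a s ->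
  bad d (a :: s) -> 0 < a.
Proof.
move=> dM; case: a => // /(order_path_min geq_trans)/allP s0.
suff -> : s = nseq (size s) 0 by rewrite (bad_nseq0 _ (_.+1)).
by apply/all_pred1P/allP => x /s0 /=; lia.
Qed.

(** * Rewriting to normal form *)

Lemma sorted_step d s : sorted geq s -> sorted geq (step d s).
Proof. by rewrite /step; case: ifP => // _ _; apply/sort_sorted/geq_total. Qed.

Lemma size_step d s : macaulay_sequence d -> size (step d s) = size s.
Proof.
rewrite /step => dM; case: ifP => //; case: s => [|a s]; rewrite ?bad_nil //.
by rewrite size_sort.
Qed.

Lemma sumn_step d s : macaulay_sequence d -> sorted geq s -> bad d s ->
  sumn s = (sumn (step d s)).+1.
Proof.
rewrite /step => dM ss bs; rewrite bs sumn_sort.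
case: s ss bs => [|a s] ss bs; first by rewrite bad_nil in bs.
by have /= := bad_head_gt0 _ _ _ dM ss bs; lia.
Qed.

Lemma step_id d s : ~~ bad d s -> step d s = s.
Proof. by rewrite /step => /negPf->. Qed.

Lemma normal_form_sort d s : normal_form d (sort geq s) = normal_form d s.
Proof.
by rewrite /normal_form sumn_sort [sort _ (sort _ _)]sort_geq_id //;
  apply/sort_sorted/geq_total.
Qed.

Lemma normal_form_perm d s t : perm_eq s t -> normal_form d s = normal_form d t.
Proof.
move=> st; rewrite -normal_form_sort -[RHS]normal_form_sort.
by rewrite (perm_sort_geq _ _ st).
Qed.

Lemma normal_form_id d s : sorted geq s -> ~~ bad d s -> normal_form d s = s.
Proof.
by move=> ss bs; rewrite /normal_form sort_geq_id //; apply/iter_fix/step_id.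
Qed.

Lemma normal_form_step d s : macaulay_sequence d -> sorted geq s ->
  normal_form d (step d s) = normal_form d s.
Proof.
move=> dM ss; case: (boolP (bad d s)) => [bs|/step_id->//].
rewrite /normal_form (sumn_step _ _ dM ss bs) iterSr !sort_geq_id //.
exact: sorted_step.
Qed.

Lemma normal_formP d s : macaulay_sequence d ->
  [/\ sorted geq (normal_form d s), size (normal_form d s) = size s &
      ~~ bad d (normal_form d s)].
Proof.
move=> dM; rewrite -normal_form_sort -(size_sort geq s).
have : sorted geq (sort geq s) by apply/sort_sorted/geq_total.
move: (sort geq s) => {}s; have [n] := ubnP (sumn s).
elim: n s => // n IHn s ltn ss; case: (boolP (bad d s)) => bs.
  have := sumn_step _ _ dM ss bs => E.
  rewrite -normal_form_step // -(size_step d s dM); apply: IHn; first by lia.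
  exact: sorted_step.
by rewrite normal_form_id.
Qed.

(** * Compatibility of normal forms with products *)

Lemma normal_form_pred d b s : macaulay_sequence d -> all (geq b) s ->
  bad d (sort geq (b :: s)) ->
  normal_form d (b :: s) = normal_form d (b.-1 :: s).
Proof.
move=> dM bs; rewrite -normal_form_sort -normal_form_step //; last first.
  exact/sort_sorted/geq_total.
rewrite /step => ->; rewrite (sort_geq_cons b) // normal_form_sort /=.
by apply: normal_form_perm; rewrite perm_cons perm_sort.
Qed.

Lemma normal_form_cons_step d j m : macaulay_sequence d -> sorted geq m ->
  normal_form d (j :: m) = normal_form d (j :: step d m).
Proof.
move=> dM; case: (boolP (bad d m)) => [|/step_id->//].
case: m => [|a s]; first by rewrite bad_nil.
move=> bas as_; have a0 := bad_head_gt0 _ _ _ dM as_ bas.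
have /andP[alls _] : all (geq a) s && sorted geq s by rewrite -path_geqE.
have allw : all (geq a) (step d (a :: s)).
  rewrite /step bas all_sort /=; apply/andP; split=> //=; lia.
have allas : all (geq a) (a :: s) by rewrite /= leqnn.
(* The product with [y_i] is bad by the ideal property and still has largest variable [y_a], so its
   step lowers the same variable. *)
have le_case i : i <= a ->
    normal_form d (i :: a :: s) = normal_form d (i :: step d (a :: s)).
  move=> ia.
  have swap : perm_eq (i :: a :: s) (a :: i :: s).
    by rewrite (perm_catCA [:: i] [:: a] s).
  rewrite (normal_form_perm _ _ _ swap).
  rewrite normal_form_pred //=; first last.
  - by rewrite -(perm_sort_geq _ _ swap); apply: bad_sort_cons.
  - by rewrite ia.
  apply: normal_form_perm; rewrite /step bas /=.
  rewrite (perm_catCA [:: a.-1] [:: i] s) /= perm_cons perm_sym.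
  by rewrite perm_sort.
(* Weakening [a < j] to [a <= j] lets the induction on [j] end at [j = a], covered by [le_case]. *)
have [/le_case//|/ltnW] := leqP j a.
elim: j => [|j IHj]; first by move=> _; apply: le_case.
rewrite leq_eqVlt => /orP[/eqP aj|]; first by apply: le_case; rewrite aj.
rewrite ltnS => aj.
have down w : sorted geq w -> size w = (size s).+1 -> all (geq a) w ->
    normal_form d (j.+1 :: w) = normal_form d (j :: w).
  move=> ws wsz aw; have jw : all (geq j.+1) w.
    by apply: sub_all aw => x /=; lia.
  rewrite normal_form_pred // sort_geq_cons // sort_geq_id //.
  exact: (bad_cons_gt _ a _ s).
rewrite !down ?IHj ?size_step //; exact: sorted_step.
Qed.

Lemma normal_form_cons d j s : macaulay_sequence d ->
  normal_form d (j :: normal_form d s) = normal_form d (j :: s).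
Proof.
move=> dM; rewrite -normal_form_sort.
rewrite [RHS](@normal_form_perm d _ (j :: sort geq s)); last first.
  by rewrite perm_cons perm_sym perm_sort.
rewrite normal_form_sort [X in _ :: X]/normal_form.
have : sorted geq (sort geq s) by apply/sort_sorted/geq_total.
(* Any number of steps will do, so the count is detached from [sumn s] for the induction. *)
move: (sort geq s) (sumn s) => {}s n; elim: n s => // n IHn s ss.
rewrite iterSr [RHS]normal_form_cons_step //; apply: IHn; exact: sorted_step.
Qed.

Lemma normal_form_catr d s t : macaulay_sequence d ->
  normal_form d (s ++ normal_form d t) = normal_form d (s ++ t).
Proof.
move=> dM; elim: s => [|j s IHs] /=.
  by have [ss _ bs] := normal_formP _ t dM; apply: normal_form_id.
by rewrite -normal_form_cons // IHs normal_form_cons.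
Qed.

Lemma normal_form_catC d s t : normal_form d (s ++ t) = normal_form d (t ++ s).
Proof. by apply: normal_form_perm; rewrite perm_catC. Qed.

(** Both sides are the normal form of the whole concatenation. Unsorted lists are included, so all
    of [seq nat] can carry the semigroup. *)
Lemma normal_form_catA d s t u : macaulay_sequence d ->
  normal_form d (s ++ normal_form d (t ++ u)) =
  normal_form d (normal_form d (s ++ t) ++ u).
Proof.
move=> dM; rewrite normal_form_catr // [RHS]normal_form_catC.
by rewrite normal_form_catr // [RHS]normal_form_catC catA.
Qed.

(** * Standard monomials and sumsets *)

Local Open Scope classical_set_scope.

Definition standard (d : nat -> nat) (h : nat) : set (seq nat) :=
  [set s | [/\ sorted geq s, size s = h & ~~ bad d s]].

Lemma standard_card d h : macaulay_sequence d ->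
  (standard d h #= `I_(d h))%card.
Proof.
move=> dM; suff <- : rank @` standard d h = `I_(d h).
  rewrite card_eq_sym; apply: inj_card_eq => s t.
  by rewrite !inE => -[ss sh _] [ts th _]; apply: rank_inj; rewrite ?sh.
apply/seteqP; split=> [_ [s [_ <- bs] <-]|k /= kd].
  by rewrite /= ltnNge.
case: (posnP h) kd => [->|h0 kd].
  case: (dM) => -> _ _; case: k => // _; exists [::] => //.
  by split=> //; rewrite bad_nil.
have [s [ss sh rs _]] := macaulay_rank _ k h0.
by exists s => //; split=> //; rewrite /bad sh rs -ltnNge.
Qed.

Lemma standard_behead d h a s : macaulay_sequence d ->
  standard d h.+1 (a :: s) -> standard d 1 [:: a] /\ standard d h s.
Proof.
move=> dM; elim: h s => [|h IHh] [|b s].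
- by move=> as_; split=> //; split=> //; rewrite bad_nil.
- by case.
- by case.
case=> ss [sh] bs.
have hs : standard d h.+1 (b :: s).
  split; [exact: path_sorted ss|by rewrite /= sh|].
  apply: contra bs => bbs; apply: (bad_rem _ a) => //; first exact: mem_head.
  by rewrite /= eqxx.
split=> //; apply: (IHh s _).1; split; [|by rewrite /= sh|].
  by apply: (subseq_sorted geq_trans _ ss); rewrite /= eqxx; apply: subseq_cons.
apply: contra bs => bas; apply: (bad_rem _ b) => //.
  by rewrite !inE eqxx orbT.
by rewrite /=; case: eqVneq bas => [->|_]; rewrite ?eqxx.
Qed.

Theorem theorem4p12 (d : nat -> nat)
  (d_gt0 : forall i, 0 < d i)
  (d0 : d 0 = 1)
  (d_macaulay : forall i, 1 <= i -> 1 <= d i.+1 <= macaulay i (d i)) :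
  exists (G : addSemigroupType) (A : set G),
    forall h, (sumset A h #= `I_(d h))%card.
Proof.
have dM : macaulay_sequence d by split=> // i /d_macaulay /andP[].
pose addC : commutative (fun s t => normal_form d (s ++ t)) :=
  fun s t => normal_form_catC d s t.
pose addA : associative (fun s t => normal_form d (s ++ t)) :=
  fun s t u => normal_form_catA d s t u dM.
pose G : addSemigroupType :=
  HB.pack_for addSemigroupType (seq nat)
    (Algebra.isAddSemigroup.Build (seq nat) addC addA).
exists G, (standard d 1 : set G) => h.
case: h => [|h].
  by rewrite sumset0 d0; apply: card_set1.
suff -> : sumset (standard d 1 : set G) h.+1 = Some @` standard d h.+1.
  apply: card_eq_trans (standard_card _ h.+1 dM).
  by apply: inj_card_eq => s t _ _ [].
elim: h => [|h IHh]; first exact: sumset1.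
rewrite sumsetS IHh; apply/seteqP.
split=> [_ [x xA [y [z zh [<-]] <-]]|_ [s sh <-]].
  exists (normal_form d (x ++ z)) => //.
  have [ss sz bs] := normal_formP _ (x ++ z) dM; split=> //.
  by case: xA zh => _ x1 _ [_ zh _]; rewrite sz size_cat x1 zh.
case: s sh => [|a s] sh; first by case: sh.
have [a1 hs] := standard_behead _ _ _ _ dM sh.
exists [:: a] => //; exists s; first by exists s.
congr Some; case: sh => ss _ bs; exact: normal_form_id.
Qed.
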